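(* Let $1<p\le 2$ and let $p^*$ be its Hölder conjugate. Let $\sigma_j=j^{-\lambda}$, $j\in\mathbb{N}$, for some $\lambda$ with $0<\lambda<\frac1{p^*}$. Then for every $\varepsilon\in(0,1)$ and every $n\in\mathbb{N}$ there is $m_0>n$ such that for all integers $m\ge m_0$, $$ \mathbb{P}\Big[\mathrm{rad}(\mathcal{E}_{p,\sigma}^m,G_{n,m})\ge\frac12\Big]\ge 1-\varepsilon. $$
   Context: For $1\le p<\infty$ and $x\in\mathbb{R}^m$, $\|x\|_p=(|x_1|^p+\cdots+|x_m|^p)^{1/p}$. For semiaxes $\sigma_1\ge\cdots\ge\sigma_m>0$, the $\ell_p$-ellipsoid is $\mathcal{E}_{p,\sigma}^m=\{x\in\mathbb{R}^m:\|(x_j/\sigma_j)_{j=1}^m\|_p\le 1\}$. $G_{n,m}\in\mathbb{R}^{n\times m}$ is a random matrix with i.i.d. standard Gaussian entries, and $\mathrm{rad}(\mathcal{E}_{p,\sigma}^m,G_{n,m}):=\sup\{\|x\|_2:x\in\mathcal{E}_{p,\sigma}^m,\ G_{n,m}x=0\}$. The Hölder conjugate satisfies $\frac1p+\frac1{p^*}=1$. *)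

(* Defs.v *)
From HB Require Import structures.
From mathcomp Require Export all_boot all_order all_algebra finmap.
From mathcomp Require Export all_classical all_reals all_analysis.

Set Implicit Arguments.
Unset Strict Implicit.
Unset Printing Implicit Defensive.

Import Order.TTheory GRing.Theory Num.Theory.
Import numFieldNormedType.Exports.

Local Open Scope classical_set_scope.
Local Open Scope ring_scope.

Section ellipsoids.
Variable R : realType.

Definition lpnorm (p : R) (m : nat) (x : 'cV[R]_m) : R :=
  (\sum_(j < m) `|x j 0| `^ p) `^ p^-1.

Definition ellipsoid (p : R) (m : nat) (sigma : 'I_m -> R) : set 'cV[R]_m :=
  [set x | lpnorm p (\col_j (x j 0 / sigma j)) <= 1].

(* The supremum is taken in the extended reals, so that it needs no convention
   for unbounded sets. *)
Definition rad (n m : nat) (K : set 'cV[R]_m) (A : 'M[R]_(n, m)) : \bar R :=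
  ereal_sup [set (lpnorm 2 x)%:E | x in K `&` [set x | A *m x = 0]].

(* Indices start at 0 in 'I_m, hence the shift. *)
Definition poly_semiaxes (lambda : R) (m : nat) : 'I_m -> R :=
  fun j => j.+1%:R `^ (- lambda).

End ellipsoids.

Section gaussian.
Context {R : realType} {d : measure_display} {T : measurableType d}.
Variable P : probability T R.

Definition mutually_independent (I : choiceType) (X : I -> {RV P >-> R}) : Prop :=
  forall (J : {fset I}) (B : I -> set R), (forall i, measurable (B i)) ->
    P (\bigcap_(i in [set` J]) (X i @^-1` B i)) =
    (\prod_(i <- J) P (X i @^-1` B i))%E.

(* Laws are compared on Borel sets only: [distribution] and [normal_prob] are
   total functions on [set R], with no meaning off the measurable sets. *)
Definition standard_gaussian (X : {RV P >-> R}) : Prop :=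
  forall B : set R, measurable B -> distribution P X B = normal_prob 0 1 B.

Definition iid_gaussian_entries (n m : nat)
    (G : 'I_n -> 'I_m -> {RV P >-> R}) : Prop :=
  mutually_independent (fun ij : 'I_n * 'I_m => G ij.1 ij.2) /\
  forall i j, standard_gaussian (G i j).

Definition random_matrix (n m : nat) (G : 'I_n -> 'I_m -> {RV P >-> R})
    (w : T) : 'M[R]_(n, m) := \matrix_(i, j) G i j w.

End gaussian.

(* Main.v *)
Require Import Defs.
From mathcomp Require Import measurable_realfun ring lra.
Import Order.TTheory GRing.Theory Num.Theory.
Import numFieldNormedType.Exports.
Set Implicit Arguments.
Unset Strict Implicit.
Unset Printing Implicit Defensive.
Local Open Scope classical_set_scope.
Local Open Scope ring_scope.

(** The first semiaxis equals 1, so the ellipsoid has room for a vector [x] with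
    first coordinate 1/2: this coordinate uses 2^-p <= 1/2 of the p-budget and
    already forces the Euclidean norm of [x] to be at least 1/2. What has to be
    shown is that, for m large, the other coordinates can be chosen so that
    [G x = 0] at p-cost at most 1/2.

    Put delta = 1 / (2 n). For each basis vector e_i of R^n, a column of [G] is
    within delta of e_i (entrywise) with a probability q_i > 0 that depends on n
    only. Hence among the m remaining columns about q_i m are near e_i, and
    Chebyshev's inequality makes it likely that at least q_i m / 2 of them are
    ([probability_few_events], [few_columns_near_basis]). The averages of these n
    groups of columns form an n x n matrix that is entrywise within delta of the
    identity, so it is invertible with an inverse bounded by 2 in the maximum
    norm. The entries of the first column are at most M in absolute value with
    high probability ([probability_tail_small]). Solving a linear system in the
    matrix of averages cancels the contribution of this column, and spreading
    the solution uniformly over each group gives a kernel vector whose remaining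
    coordinates are all at most C / m ([kernel_vector_of_clusters]).

    The p-cost of these coordinates is at most
    m (m+1)^(lambda p) (C / m)^p = O(m^(1 + lambda p - p)). The exponent is
    negative exactly when lambda < 1 - 1/p = 1/p*, which is the hypothesis on
    lambda ([eventually_small_spread]).

    The event in the theorem is defined through a supremum over an uncountable
    set, so its measurability needs an argument. Compactness of the ellipsoid
    turns the event into a countable combination of conditions on [G q], with
    [q] a rational vector ([rad_geP], [measurable_rad_ge]). *)

(** * Short kernel vectors from groups of nearly basis columns *)

(** Row-wise, [H] differs from the identity by at most 1/2 in l1-norm, so by a
    Neumann-type argument its inverse has norm at most 2 on l_infinity. *)
Lemma near_identity_bound (R : realFieldType) (n : nat) (H : 'M[R]_n)
  (z : 'cV[R]_n) (B : R) :
  (forall r i, `|H r i - (r == i)%:R| <= (2 * n%:R)^-1) ->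
  (forall r, `|(H *m z) r 0| <= B) -> forall i, `|z i 0| <= 2 * B.
Proof.
move=> Hid HzB i.
(* At an index of largest modulus, the off-identity part of [H] can absorb at
   most half of that modulus. *)
pose k := [arg max_(k > i) `|z k 0|]%O.
have zk r : `|z r 0| <= `|z k 0| by rewrite /k; case: arg_maxP => // ? _; exact.
have n0 : 0 < n%:R :> R by rewrite ltr0n (leq_trans _ (ltn_ord i)).
suff : `|z k 0| <= B + `|z k 0| / 2 by move: (zk i); lra.
have zkE : z k 0 = (H *m z) k 0 - \sum_r (H k r - (k == r)%:R) * z r 0.
  under [X in _ - X]eq_bigr do rewrite mulrBl.
  rewrite sumrB mxE opprB addrC subrK (bigD1 k)//= eqxx mul1r big1 ?addr0//.
  move=> r.
  by rewrite eq_sym => /negPf ->; rewrite mul0r.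
rewrite [X in `|X| <= _]zkE (le_trans (ler_normB _ _))// lerD//.
rewrite (le_trans (ler_norm_sum _ _ _))//.
rewrite (@le_trans _ _ (\sum_(r < n) (2 * n%:R)^-1 * `|z k 0|))//.
  by apply: ler_sum => r _; rewrite normrM ler_pM.
rewrite sumr_const card_ord -mulr_natr le_eqVlt; apply/orP; left; apply/eqP.
field.
by rewrite gt_eqF.
Qed.

Lemma near_identity_unitmx (R : realFieldType) (n : nat) (H : 'M[R]_n) :
  (forall r i, `|H r i - (r == i)%:R| <= (2 * n%:R)^-1) -> H \in unitmx.
Proof.
move=> Hid; rewrite -unitmx_tr -row_free_unit.
apply: inj_row_free => v vH0; apply/rowP => i.
have Hv0 : H *m v^T = 0 by rewrite -[H]trmxK -trmx_mul vH0 trmx0.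
have := @near_identity_bound _ _ H v^T 0 Hid _ i.
rewrite Hv0 !mxE mulr0 normr_le0 => /(_ _)/eqP; apply => r.
by rewrite mxE normr0.
Qed.

(** The averages of the columns over the groups [S i] form a matrix near the
    identity. The weight that the solution of the linear system gives to the
    i-th group is spread uniformly over [S i]; this makes the coordinates of
    order 1 / s. *)
Lemma kernel_vector_of_clusters (R : realFieldType) (n m : nat)
  (A : 'M[R]_(n, m.+1)) (S : 'I_n -> {set 'I_m}) (s M : R) :
  0 < s -> (forall i, s <= #|S i|%:R) ->
  (forall i j r, j \in S i ->
     `|A r (lift ord0 j) - (r == i)%:R| <= (2 * n%:R)^-1) ->
  (forall r, `|A r 0| <= M) ->
  exists x : 'cV[R]_m.+1, [/\ A *m x = 0, x 0 0 = 2^-1 &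
    forall j, `|x (lift ord0 j) 0| <= n%:R * M / s].
Proof.
move=> s0 sS AS AM.
have S0 i : 0 < #|S i|%:R :> R by exact: lt_le_trans (sS i).
pose H := \matrix_(r, i) (\sum_(j in S i) A r (lift ord0 j) / #|S i|%:R).
have Hid r i : `|H r i - (r == i)%:R| <= (2 * n%:R)^-1.
  have -> : H r i - (r == i)%:R =
      \sum_(j in S i) (A r (lift ord0 j) - (r == i)%:R) / #|S i|%:R.
    rewrite mxE -!mulr_suml sumrB mulrBl sumr_const.
    by rewrite -(mulr_natr (r == i)%:R #|S i|) mulfK// gt_eqF.
  rewrite (le_trans (ler_norm_sum _ _ _))//.
  rewrite (@le_trans _ _ (\sum_(j in S i) (2 * n%:R)^-1 / #|S i|%:R))//.
    apply: ler_sum => j jS; rewrite normrM normfV normr_nat.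
    by rewrite ler_pM2r ?invr_gt0// AS.
  by rewrite sumr_const -[_ / _ *+ _]mulr_natr mulfVK ?gt_eqF//.
(* The group averages have to cancel the first column taken with weight 1/2. *)
pose b := - 2^-1 *: col 0 A.
have [z Hz] : exists z, H *m z = b.
  by exists (invmx H *m b); rewrite mulKVmx// near_identity_unitmx.
have zM i : `|z i 0| <= M.
  have -> : M = 2 * (2^-1 * M) by rewrite mulrA mulfV// mul1r.
  apply: (near_identity_bound Hid) => r; rewrite Hz !mxE normrM normrN.
  by rewrite [ `|2^-1| ]ger0_norm ?invr_ge0// ler_pM2l ?invr_gt0.
(* Summing over all the groups that contain [j] makes the formula correct
   whether or not the groups overlap. *)
pose y j := \sum_i (if j \in S i then z i 0 / #|S i|%:R else 0).
exists (\col_k (if unlift ord0 k is Some j then y j else 2^-1)); split.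
- apply/colP => r; rewrite !mxE big_ord_recl mxE unlift_none/=.
  under eq_bigr do rewrite mxE liftK /y mulr_sumr.
  rewrite exchange_big/=.
  transitivity (A r 0 / 2 + (H *m z) r 0); last first.
    by rewrite Hz !mxE mulNr mulrC subrr.
  rewrite [X in _ = _ + X]mxE; congr (_ + _); apply: eq_bigr => i _.
  rewrite mxE mulr_suml [RHS]big_mkcond/=; apply: eq_bigr => j _.
  by case: ifP => _; rewrite ?mulr0// mulrA mulrAC.
- by rewrite mxE unlift_none.
- move=> j; rewrite mxE liftK (le_trans (ler_norm_sum _ _ _))//.
  rewrite (@le_trans _ _ (\sum_(i < n) M / s))//; last first.
    by rewrite sumr_const card_ord -[leLHS]mulr_natl mulrA.
  apply: ler_sum => i _; case: ifP => _; last first.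
    by rewrite normr0 divr_ge0 ?(ltW s0)// (le_trans _ (zM i)).
  rewrite normrM normfV normr_nat ler_pM//.
  by rewrite lef_pV2 ?posrE.
Qed.

(** * Fitting the kernel vector into the ellipsoid *)

Lemma normr_le_lpnorm (R : realType) (p : R) (m : nat) (x : 'cV[R]_m) :
  0 < p -> forall j, `|x j 0| <= lpnorm p x.
Proof.
move=> p0 j; have -> : `|x j 0| = (`|x j 0| `^ p) `^ p^-1.
  by rewrite -powRrM mulfV ?gt_eqF// powRr1.
have sum0 P : 0 <= \sum_(i < m | P i) `|x i 0| `^ p.
  by apply: sumr_ge0 => i _; exact: powR_ge0.
rewrite ge0_ler_powR ?nnegrE ?powR_ge0 ?invr_ge0 ?(ltW p0)//.
by rewrite (bigD1 j)//= lerDl.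
Qed.

(** The expression is of order m^(1 + lambda p - p), with a negative exponent
    because lambda < 1 - 1/p. *)
Lemma eventually_small_spread (R : realType) (p lambda C : R) :
  1 < p -> 0 < lambda -> lambda < 1 - p^-1 -> 0 <= C ->
  exists m0 : nat, forall m : nat, (m0 <= m)%N ->
    m%:R * (m.+1%:R `^ lambda * (C / m%:R)) `^ p <= 2^-1.
Proof.
move=> p1 l0 lp C0.
have p0 : 0 < p by exact: lt_trans p1.
pose a := p - 1 - lambda * p.
have a0 : 0 < a.
  have : lambda * p < (1 - p^-1) * p by rewrite ltr_pM2r.
  by rewrite mulrBl mul1r mulVf ?gt_eqF// /a; lra.
(* The left-hand side is at most [D * m ^ (- a)], since m + 1 <= 2 m. *)
pose D := (2 `^ lambda * C) `^ p.
have D0 : 0 <= D by exact: powR_ge0.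
exists (Num.trunc ((2 * D) `^ a^-1)).+1 => m mD.
have {}mD : (2 * D) `^ a^-1 <= m%:R.
  by rewrite ltW// (lt_le_trans (truncnS_gt _))// ler_nat.
have [->|m_gt0] := posnP m; first by rewrite mul0r.
have m0 : 0 < m%:R :> R by rewrite ltr0n.
have aE : 1 + (lambda - 1) * p = - a by rewrite /a; ring.
apply: (@le_trans _ _ (D * (m%:R `^ (- a)))).
  have -> : D * m%:R `^ (- a) =
      m%:R * (2 `^ lambda * m%:R `^ lambda * (C / m%:R)) `^ p.
    have -> : 2 `^ lambda * m%:R `^ lambda * (C / m%:R) =
        2 `^ lambda * C * m%:R `^ (lambda - 1).
      rewrite powRD ?(gt_eqF m0) ?implybT// powRN powRr1 ?(ltW m0)//; ring.
    rewrite powRM ?mulr_ge0 ?powR_ge0// -/D -powRrM -aE.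
    rewrite powRD ?(gt_eqF m0) ?implybT//.
    rewrite powRr1 ?(ltW m0)//; ring.
  rewrite ler_wpM2l ?(ltW m0)// ge0_ler_powR ?nnegrE ?(ltW p0)//.
  - by rewrite mulr_ge0 ?powR_ge0// divr_ge0// ltW.
  - by rewrite !mulr_ge0 ?powR_ge0// invr_ge0 ltW.
  rewrite ler_wpM2r ?divr_ge0 ?(ltW m0)// -powRM ?(ltW m0)//.
  rewrite ge0_ler_powR ?nnegrE ?(ltW l0) ?mulr_ge0 ?(ltW m0)//.
  by rewrite -natrM ler_nat mul2n -addnn -addn1 leq_add2l.
rewrite powRN ler_pdivrMr ?powR_gt0//.
suff : 2 * D <= m%:R `^ a by lra.
have -> : 2 * D = ((2 * D) `^ a^-1) `^ a.
  by rewrite -powRrM mulVf ?gt_eqF// powRr1// mulr_ge0.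
by rewrite ge0_ler_powR ?nnegrE ?powR_ge0 ?(ltW a0) ?(ltW m0).
Qed.

(** The largest scaling factor of the remaining coordinates is
    (m+1)^lambda, so these cost at most the left-hand side of the last
    hypothesis; the first coordinate costs 2^-p <= 1/2. *)
Lemma spread_vector_in_ellipsoid (R : realType) (p lambda t : R) (m : nat)
  (x : 'cV[R]_m.+1) :
  1 < p -> 0 < lambda -> x 0 0 = 2^-1 ->
  (forall j, `|x (lift ord0 j) 0| <= t) ->
  m%:R * (m.+1%:R `^ lambda * t) `^ p <= 2^-1 ->
  ellipsoid p (@poly_semiaxes R lambda m.+1) x.
Proof.
move=> p1 l0 x0 xt small; rewrite /ellipsoid/= /lpnorm.
have p0 : 0 < p by exact: lt_trans p1.
suff S1 : \sum_(j < m.+1)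
    `|(\col_j (x j 0 / poly_semiaxes lambda j)) j 0| `^ p <= 1.
  have -> : 1 = 1 `^ p^-1 :> R by rewrite powR1.
  rewrite ge0_ler_powR ?nnegrE ?invr_ge0 ?(ltW p0)//.
  by apply: sumr_ge0 => j _; exact: powR_ge0.
have -> : 1 = 2^-1 + 2^-1 :> R by lra.
rewrite big_ord_recl lerD//.
  rewrite mxE x0 /poly_semiaxes/= powR1 divr1 ger0_norm ?invr_ge0//.
  by apply: ge1r_powR; [lra|exact: ltW].
apply: le_trans small.
rewrite -[m in m%:R]card_ord mulr_natl -sumr_const; apply: ler_sum => j _.
rewrite ge0_ler_powR ?nnegrE ?(ltW p0)//.
  by rewrite mulr_ge0 ?powR_ge0// (le_trans _ (xt j)).
rewrite mxE normrM mulrC /poly_semiaxes powRN invrK.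
rewrite (ger0_norm (powR_ge0 _ _)) ler_pM ?powR_ge0//.
by rewrite ge0_ler_powR ?nnegrE ?(ltW l0)// ler_nat ltnS; exact: ltn_ord.
Qed.

Lemma rad_ge_half_of_clusters (R : realType) (p lambda : R) (n m : nat)
  (A : 'M[R]_(n, m.+1)) (S : 'I_n -> {set 'I_m}) (s M : R) :
  1 < p -> 0 < lambda -> 0 < s -> (forall i, s <= #|S i|%:R) ->
  (forall i j r, j \in S i ->
     `|A r (lift ord0 j) - (r == i)%:R| <= (2 * n%:R)^-1) ->
  (forall r, `|A r 0| <= M) ->
  m%:R * (m.+1%:R `^ lambda * (n%:R * M / s)) `^ p <= 2^-1 ->
  ((2^-1)%:E <= rad (ellipsoid p (@poly_semiaxes R lambda m.+1)) A)%E.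
Proof.
move=> p1 l0 s0 sS AS AM small.
have [x [Ax0 x0 xs]] := kernel_vector_of_clusters s0 sS AS AM.
have two0 : 0 < 2 :> R by [].
apply: (@le_trans _ _ (lpnorm 2 x)%:E).
  have := normr_le_lpnorm x two0 0.
  by rewrite lee_fin x0 ger0_norm// invr_ge0.
apply: ereal_sup_ubound; exists x => //; split => //.
exact: spread_vector_in_ellipsoid p1 l0 x0 xs small.
Qed.

(** * Counting pairwise independent events *)

Lemma integral_sum_indic (R : realType) (d : measure_display)
  (T : measurableType d) (P : {measure set T -> \bar R}) (K : Type) (s : seq K)
  (c : K -> R) (A : K -> set T) :
  (forall k, 0 <= c k) -> (forall k, measurable (A k)) ->
  (\int[P]_w (\sum_(k <- s) c k * \1_(A k) w)%:E =
   \sum_(k <- s) (c k)%:E * P (A k))%E.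
Proof.
move=> c0 mA.
under eq_integral do rewrite -sumEFin.
rewrite ge0_integral_sum//.
- apply: eq_bigr => k _.
  under eq_integral do rewrite EFinM.
  rewrite ge0_integralZl_EFin ?integral_indic ?setIT//.
  exact/measurable_EFinP/measurable_indic.
- by move=> k; apply/measurable_EFinP; apply: measurable_funM.
- by move=> k w _; rewrite lee_fin mulr_ge0.
Qed.

(** Chebyshev's inequality for the number [S] of events that occur, with mean
    N q. To integrate nonnegative functions only, the bound
    (N q / 2)^2 1_B <= (S - N q)^2 is used in the form
    (N q / 2)^2 1_B + 2 N q S <= S^2 + (N q)^2; pairwise independence gives the
    integral of S^2. *)
Lemma probability_few_events (R : realType) (d : measure_display)
  (T : measurableType d) (P : probability T R) (I : finType) (A : I -> set T)
  (q : R) :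
  (0 < #|I|)%N -> 0 < q -> (forall i, measurable (A i)) ->
  (forall i, P (A i) = q%:E) ->
  (forall i j, i != j -> P (A i `&` A j) = (q ^+ 2)%:E) ->
  let few := [set w | (#|[set i | w \in A i]%SET|%:R <
                       #|I|%:R * q / 2 :> R)%R] in
  measurable few /\ (P few <= (4 / (#|I|%:R * q))%:E)%E.
Proof.
move=> I0 q0 mA PA PAA.
set N : R := #|I|%:R => B.
have N0 : 0 < N by rewrite ltr0n.
have Nq0 : 0 < N * q by rewrite mulr_gt0.
pose S w : R := \sum_i \1_(A i) w.
have SE w : S w = #|[set i | w \in A i]%SET|%:R.
  rewrite /S cardsE -sum1_card natr_sum [RHS]big_mkcond/=.
  apply: eq_bigr => i _; rewrite indicE.
  by transitivity (if w \in A i then 1 else 0 : R); first by case: (w \in A i).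
have mS : measurable_fun setT S.
  by apply: measurable_sum => i; exact: measurable_indic.
have mB : measurable B.
  rewrite [B](_ : _ = S @^-1` `]-oo, (N * q / 2)%R[).
    rewrite -[_ @^-1` _]setTI; exact: mS.
  by apply/seteqP; split => w /=; rewrite in_itv/= SE.
split => //.
(* [None] stands for the event [B] on the left and for the constant term on the
   right of the pointwise inequality below. *)
pose c1 (k : option I) : R :=
  if k is Some _ then 2 * (N * q) else (N * q / 2) ^+ 2.
pose A1 (k : option I) := if k is Some i then A i else B.
have c1_ge0 k : 0 <= c1 k.
  by case: k => [i|] /=; [rewrite mulr_ge0 // ltW | rewrite sqr_ge0].
have mA1 k : measurable (A1 k) by case: k.
pose c2 (k : option (I * I)) : R := if k is Some _ then 1 else (N * q) ^+ 2.
pose A2 (k : option (I * I)) :=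
  if k is Some ij then A ij.1 `&` A ij.2 else setT.
have c2_ge0 k : 0 <= c2 k by case: k => [i|] /=; [ | rewrite sqr_ge0].
have mA2 k : measurable (A2 k) by case: k => //= ij; exact: measurableI.
have lhsE := integral_sum_indic P (None :: map Some (index_enum I)) c1_ge0 mA1.
have rhsE := integral_sum_indic P
  (None :: map Some (index_enum (I * I)%type)) c2_ge0 mA2.
have pointwise w :
    \sum_(k <- None :: map Some (index_enum I)) c1 k * \1_(A1 k) w <=
    \sum_(k <- None :: map Some (index_enum (I * I)%type)) c2 k * \1_(A2 k) w.
  rewrite !big_cons !big_map/= -mulr_sumr indicT mulr1 -/(S w).
  rewrite (_ : \sum_(k : I * I) _ = S w ^+ 2); last first.
    rewrite expr2 /S big_distrlr/= pair_bigA/=; apply: eq_bigr => k _.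
    by rewrite mul1r indicI.
  have -> : (N * q / 2) ^+ 2 * \1_B w + 2 * (N * q) * S w <=
            (N * q) ^+ 2 + S w ^+ 2 ; last by [].
  rewrite indicE; case: (boolP (w \in B)); last first.
    by move=> _; rewrite mulr0; have := sqr_ge0 (N * q - S w); lra.
  rewrite inE /B /= -SE => SB; rewrite mulr1.
  have : (N * q / 2) ^+ 2 <= (N * q - S w) ^+ 2.
    by rewrite ler_sqr ?nnegrE ?divr_ge0 ?ltW//; lra.
  lra.
have : (\int[P]_w (\sum_(k <- None :: map Some (index_enum I))
          c1 k * \1_(A1 k) w)%:E <=
        \int[P]_w (\sum_(k <- None :: map Some (index_enum (I * I)%type))
          c2 k * \1_(A2 k) w)%:E)%E.
  apply: ge0_le_integral => //.
  - by move=> w _; rewrite lee_fin sumr_ge0// => k _; rewrite mulr_ge0.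
  - apply/measurable_EFinP; apply: measurable_sum => k.
    by apply: measurable_funM.
  - apply/measurable_EFinP; apply: measurable_sum => k.
    by apply: measurable_funM.
  - by move=> w _; rewrite lee_fin.
rewrite lhsE rhsE !big_cons !big_map/= probability_setT mule1.
under eq_bigr do rewrite PA -EFinM.
rewrite sumEFin sumr_const -mulr_natl -/N.
rewrite -(pair_bigA _ (fun i j => 1%:E * P (A i `&` A j)))%E/=.
have -> : (\sum_i \sum_j 1%:E * P (A i `&` A j) =
           (N * q + N * (N - 1) * q ^+ 2)%:E)%E.
  transitivity (\sum_(i : I) ((q + (N - 1) * q ^+ 2)%:E : \bar R))%E.
    apply: eq_bigr => i _; rewrite (bigD1 i)//= setIid PA mul1e.
    under eq_bigr => j ij do rewrite mul1e PAA 1?eq_sym//.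
    rewrite sumEFin sumr_const -EFinD -mulr_natl cardC1 -subn1 natrB//.
  rewrite sumEFin sumr_const -mulr_natl -/N; congr (_%:E); ring.
have finPB : P B \is a fin_num by apply: fin_num_measure.
rewrite -(fineK finPB) -!EFinM -!EFinD !lee_fin ler_pdivlMr//.
set x := fine _ => H.
have x0 : 0 <= x by rewrite fine_ge0.
have : (N * q) * (N * q * x) <= (N * q) * 4 by have := sqr_ge0 q; nra.
by rewrite ler_pM2l// [x * _]mulrC.
Qed.

Lemma union_bound (R : realType) (d : measure_display) (T : measurableType d)
  (P : probability T R) (I : finType) (F : I -> set T) (A : set T) (e : R) :
  measurable A -> (forall i, measurable (F i)) ->
  (forall i, (P (F i) <= e%:E)%E) -> A `<=` \bigcup_i F i ->
  (P A <= (#|I|%:R * e)%:E)%E.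
Proof.
move=> mA mF PF AF.
apply: (le_trans (content_sub_fsum P (@finite_finset I setT) _ mA AF)) => //.
rewrite (_ : [set: I] = [set` predT]); last by apply/seteqP; split.
rewrite -(@bigfs _ _ _ _ (index_enum I)) ?index_enum_uniq//; last first.
  by move=> i _; rewrite mem_index_enum.
rewrite (le_trans (lee_sum (g := fun=> e%:E) _ (fun i _ => PF i)))//.
by rewrite sumEFin sumr_const lee_fin mulr_natl.
Qed.

(** * Gaussian columns close to basis vectors *)

(** The product rule for the entries, read column by column: each column of [C]
    lies in the box with sides [B r] with the same probability, independently of
    the other columns. *)
Lemma independent_columns (R : realType) (d : measure_display)
  (T : measurableType d) (P : probability T R) (n m : nat)
  (G : 'I_n -> 'I_m -> {RV P >-> R}) (B : 'I_n -> set R) (C : {set 'I_m}) :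
  iid_gaussian_entries G -> (forall r, measurable (B r)) ->
  P [set w | forall c, c \in C -> forall r, B r (G r c w)] =
  ((\prod_r fine (normal_prob 0 1 (B r))) ^+ #|C|)%:E.
Proof.
move=> [indep gauss] mB.
pose s := [seq (r, c) | r <- enum 'I_n, c <- enum C].
have sE r c : ((r, c) \in s) = (c \in C).
  apply/allpairsP/idP => [[[r' c']]/= [_]|cC].
    by rewrite mem_enum => c'C [_ ->].
  by exists (r, c); rewrite !mem_enum.
pose J := [fset x in s]%fset.
have := indep J (fun ij => B ij.1) (fun ij => mB ij.1).
rewrite (_ : \bigcap_(_ in _) _ =
    [set w | forall c, c \in C -> forall r, B r (G r c w)]); last first.
  apply/seteqP; split => w /= H.
    by move=> c cC r; have := H (r, c); apply; rewrite /= /J in_fset sE.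
  by move=> [r c] /=; rewrite in_fset sE => cC; exact: H.
move=> ->.
have Js : perm_eq J s.
  apply: uniq_perm; rewrite ?fset_uniq//.
    apply: allpairs_uniq; rewrite ?enum_uniq// => -[a b] [a' b'] _ _ //.
  by move=> x; rewrite in_fset.
rewrite (perm_big _ Js)/= big_allpairs/=.
transitivity (\prod_(r <- enum 'I_n)
  ((fine (normal_prob 0 1 (B r))) ^+ #|C|)%:E)%E.
  apply: eq_bigr => r _.
  rewrite (eq_bigr (fun=> (fine (normal_prob 0 1 (B r)))%:E)).
    by rewrite prodEFin big_const_seq count_predT -cardE iter_mulr_1.
  move=> c _; rewrite -(gauss r c)// fineK//.
  exact: fin_num_measure.
by rewrite prodEFin big_enum/= prodrXl.
Qed.

(** On a bounded interval the density is bounded below by a positive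
    constant. *)
Lemma normal_prob_itv_gt0 (R : realType) (mean s a b : R) :
  s != 0 -> a < b -> (0 < normal_prob mean s `[a, b])%E.
Proof.
move=> s0 ab.
pose K := Num.max `|a - mean| `|b - mean|.
pose c := normal_peak s * expR (- K ^+ 2 / (s ^+ 2 *+ 2)).
have c0 : 0 < c by rewrite mulr_gt0 ?normal_peak_gt0 ?expR_gt0.
apply: (@lt_le_trans _ _ (\int[lebesgue_measure]_(x in `[a, b]) c%:E)%E).
  rewrite integral_cst//= lebesgue_measure_itv/= lte_fin ab.
  rewrite -EFinD -EFinM lte_fin.
  by rewrite mulr_gt0// subr_gt0.
rewrite /normal_prob; apply: ge0_le_integral => //=.
- by move=> x _; rewrite lee_fin ltW.
- by apply/measurable_EFinP/measurable_funTS; exact: measurable_normal_pdf.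
- move=> x; rewrite in_itv/= => /andP[ax xb].
  rewrite lee_fin normal_pdfE// ler_pM2l ?normal_peak_gt0// ler_expR.
  rewrite !mulNr lerN2 ler_wpM2r ?invr_ge0 ?mulrn_wge0 ?sqr_ge0//.
  rewrite -[leLHS]real_normK ?num_real// ler_sqr ?nnegrE//; last first.
    by rewrite le_max normr_ge0.
  rewrite le_max; case: (lerP 0 (x - mean)) => xm.
    by apply/orP; right; rewrite ger0_norm// (le_trans _ (ler_norm _))// lerB.
  apply/orP; left; rewrite ltr0_norm// opprB distrC.
  by rewrite (le_trans _ (ler_norm _))// lerB.
Qed.

Lemma measurable_normr_gt (R : realType) (M : R) :
  measurable [set x : R | M < `|x|].
Proof.
rewrite (_ : [set _ | _] = ~` `[- M, M]); first exact: measurableC.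
apply/seteqP; split => x; rewrite /= in_itv/= -ler_norml.
  by rewrite ltNge => /negP.
by move=> /negP; rewrite -ltNge.
Qed.

(** Continuity from above of the measure along the tails, whose intersection is
    empty. *)
Lemma probability_tail_small (R : realType)
  (mu : probability (measurableTypeR R) R) (eta : R) : 0 < eta ->
  exists2 M : R, 0 < M & (mu [set x : R | (M < `|x|)%R] <= eta%:E)%E.
Proof.
move=> eta0.
pose F (k : nat) : set R := [set x | k.+1%:R < `|x|].
have mF k : measurable (F k) by exact: measurable_normr_gt.
have F0 : \bigcap_k F k = set0.
  rewrite -subset0 => x /(_ (Num.bound `|x|) I).
  rewrite /F /= ltNge => /negP; apply.
  rewrite (@le_trans _ _ (Num.bound `|x|)%:R)//; last by rewrite ler_nat.
  by rewrite ltW// archi_boundP.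
have : mu \o F @ \oo --> mu (\bigcap_k F k).
  apply: nonincreasing_cvg_mu => //.
  - by rewrite (le_lt_trans (probability_le1 mu (mF 0))) ?ltry.
  - by rewrite F0.
  - move=> k l kl; apply/subsetPset => x; rewrite /F /=; apply: le_lt_trans.
    by rewrite ler_nat ltnS.
rewrite F0 measure0 => /fine_cvgP[_ /cvgrPdist_le/(_ eta eta0)] [k _ /(_ k)/=].
rewrite leqnn => /(_ isT); rewrite sub0r normrN => Fk.
exists k.+1%:R => //.
have finF : mu (F k) \is a fin_num by apply: fin_num_measure; exact: mF.
by rewrite -/(F k) -(fineK finF) lee_fin (le_trans (ler_norm _)).
Qed.

Definition near_basis (R : realType) (d : measure_display)
  (T : measurableType d) (P : probability T R) (n m : nat)
  (G : 'I_n -> 'I_m -> {RV P >-> R}) (delta : R) (i : 'I_n) (c : 'I_m) :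
  set T := [set w | forall r, `|G r c w - (r == i)%:R| <= delta].

(** The probability of [near_basis] for a standard Gaussian column. *)
Definition near_basis_prob (R : realType) (n : nat) (delta : R)
  (i : 'I_n) : R :=
  \prod_(r < n)
    fine (normal_prob 0 1 `[(r == i)%:R - delta, (r == i)%:R + delta]).

Lemma near_basis_prob_gt0 (R : realType) (n : nat) (delta : R) (i : 'I_n) :
  0 < delta -> 0 < near_basis_prob delta i.
Proof.
move=> delta0; apply: prodr_gt0 => r _.
rewrite fine_gt0//; apply/andP; split.
  by apply: normal_prob_itv_gt0; rewrite ?oner_neq0//; lra.
by rewrite (le_lt_trans (probability_le1 _ _)) ?ltry.
Qed.

Lemma near_basis_prob_le1 (R : realType) (n : nat) (delta : R) (i : 'I_n) :
  near_basis_prob delta i <= 1.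
Proof.
apply: prodr_ile1 => r _; rewrite fine_ge0//=.
by rewrite -[leRHS]/(fine 1%E) fine_le ?fin_num_measure// probability_le1.
Qed.

(** The first column is left out because the kernel vector gives it the
    prescribed weight 1/2. *)
Lemma few_columns_near_basis (R : realType) (d : measure_display)
  (T : measurableType d) (P : probability T R) (n m : nat)
  (G : 'I_n -> 'I_m.+1 -> {RV P >-> R}) (delta : R) (i : 'I_n) :
  iid_gaussian_entries G -> 0 < delta -> (0 < m)%N ->
  let few := [set w |
     (#|[set j | w \in near_basis G delta i (lift ord0 j)]%SET|%:R <
      m%:R * near_basis_prob delta i / 2 :> R)%R] in
  measurable few /\ (P few <= (4 / (m%:R * near_basis_prob delta i))%:E)%E.
Proof.
move=> iidG delta0 m0; pose A j := near_basis G delta i (lift ord0 j).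
pose box (r : 'I_n) : set R :=
  `[(r == i)%:R - delta, (r == i)%:R + delta]%classic.
have mbox r : measurable (box r) by exact: measurable_itv.
have boxE w r c : box r (G r c w) <-> `|G r c w - (r == i)%:R| <= delta.
  by rewrite /box/= in_itv/= ler_distl.
have PC (C : {set 'I_m.+1}) := independent_columns C iidG mbox.
have mA j : measurable (A j).
  rewrite (_ : A j = \bigcap_(r in [set: 'I_n])
      (G r (lift ord0 j) @^-1` box r)); last first.
    apply/seteqP; split => w /= H r; first by move=> _; exact/boxE.
    by have := H r I; move/boxE.
  by apply: fin_bigcap_measurable => // r _; exact: measurable_funPTI.
have PA j : P (A j) = (near_basis_prob delta i)%:E.
  rewrite -[RHS]/((_ ^+ 1)%:E) -(cards1 (lift ord0 j)) -PC; congr (P _).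
  apply/seteqP; split => w /= H; first by move=> c /set1P -> r; exact/boxE.
  by move=> r; apply/boxE/H/set11.
have PAA j k : j != k -> P (A j `&` A k) = (near_basis_prob delta i ^+ 2)%:E.
  move=> jk; have <- : #|[set lift ord0 j; lift ord0 k]%SET| = 2%N.
    by rewrite cards2 (inj_eq lift_inj) jk.
  rewrite -PC; congr (P _); apply/seteqP; split => w /=.
    by move=> [Hj Hk] c /set2P[] -> r; exact/boxE.
  by move=> H; split=> r; apply/boxE/H; [exact: set21|exact: set22].
have I0 : (0 < #|'I_m|)%N by rewrite card_ord.
have := probability_few_events I0 (near_basis_prob_gt0 i delta0) mA PA PAA.
by rewrite card_ord.
Qed.

(** * Measurability of the radius event *)

Lemma continuous_normr_powR (R : realType) (s : R) :
  0 < s -> continuous (fun t : R => `|t| `^ s).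
Proof.
move=> s0 t; have [->|t0] := eqVneq t 0; last first.
  apply: (@continuous_comp _ _ _ (@Num.norm R R) (fun x => x `^ s)).
    exact: norm_continuous.
  apply/differentiable_continuous/derivable1_diffP/derivable_powR.
  by rewrite in_itv/= andbT normr_gt0.
rewrite /continuous_at normr0 powR0 ?gt_eqF//; apply/cvgrPdist_lt => e e0.
have : nbhs (0 : R) (ball (0 : R) (e `^ s^-1)).
  by apply: nbhsx_ballx; exact: powR_gt0.
apply: filterS => x; rewrite -ball_normE/= !sub0r !normrN => xe.
rewrite ger0_norm ?powR_ge0//.
have -> : e = (e `^ s^-1) `^ s by rewrite -powRrM mulVf ?gt_eqF// powRr1// ltW.
by rewrite gt0_ltr_powR// nnegrE ?powR_ge0.
Qed.

Lemma continuous_lpnorm (R : realType) (s : R) (m : nat) :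
  0 < s -> continuous (@lpnorm R s m).
Proof.
move=> s0 x.
rewrite (_ : @lpnorm R s m = (fun t => `|t| `^ s^-1) \o
  (fun x : 'cV[R]_m => \sum_(j < m) `|x j 0| `^ s)); last first.
  apply/funext => y; rewrite /lpnorm/= ger0_norm//.
  by apply: sumr_ge0 => j _; exact: powR_ge0.
apply: continuous_comp; last by apply: continuous_normr_powR; rewrite invr_gt0.
apply: continuous_big => [|j _]; first exact: add_continuous.
move=> {}x; apply: (@continuous_comp _ _ _ (fun y : 'cV[R]_m => y j 0)
  (fun t : R => `|t| `^ s)); first exact: coord_continuous.
exact: continuous_normr_powR.
Qed.

Lemma continuous_col (R : realType) (U : topologicalType) (m : nat)
  (f : U -> 'I_m -> R) :
  (forall j, continuous (f^~ j)) ->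
  continuous (fun u => \col_j f u j : 'cV[R]_m).
Proof.
move=> fc u B /nbhs_ballP[e e0 eB].
have : \forall v \near u, forall j, ball (f u j) e (f v j).
  by apply: filter_forall => j; apply: (fc j); exact: nbhsx_ballx.
by apply: filterS => v fuv; apply: eB; split => // j k; rewrite !mxE.
Qed.

Lemma compact_cube (R : realType) (m : nat) :
  compact [set x : 'cV[R]_m | forall j, `|x j 0| <= 1].
Proof.
have -> : [set x : 'cV[R]_m | forall j, `|x j 0| <= 1] =
    trmx @` [set v : 'rV[R]_m | forall j, `[(-1 : R), 1]%classic (v ord0 j)].
  apply/seteqP; split => [x xK|_ /= [v vK <-] j].
    exists x^T; rewrite ?trmxK// => j /=; rewrite in_itv/= -ler_norml mxE.
    exact: xK.
  by rewrite mxE ler_norml; have := vK j; rewrite in_itv.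
apply: continuous_compact; last first.
  by apply: (@rV_compact R m (fun=> `[-1, 1]%classic)) => _;
    exact: segment_compact.
apply: continuous_subspaceT => v.
rewrite (_ : trmx = fun v : 'rV[R]_m => \col_j v ord0 j).
  by apply: continuous_col => j; exact: coord_continuous.
by apply/funext => w; apply/matrixP => j k; rewrite !mxE (ord1 k).
Qed.

Lemma ellipsoid_coord_le (R : realType) (p : R) (m : nat) (sigma : 'I_m -> R)
  (x : 'cV[R]_m) : 0 < p -> (forall j, 0 < sigma j) ->
  ellipsoid p sigma x -> forall j, `|x j 0| <= sigma j.
Proof.
move=> p0 sigma0 x1 j; have := le_trans (normr_le_lpnorm _ p0 j) x1.
by rewrite mxE normrM normfV (gtr0_norm (sigma0 j)) ler_pdivrMr// mul1r.
Qed.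

Lemma compact_ellipsoid (R : realType) (p : R) (m : nat) (sigma : 'I_m -> R) :
  0 < p -> (forall j, 0 < sigma j <= 1) -> compact (ellipsoid p sigma).
Proof.
move=> p0 sigma01.
have sigma0 j : 0 < sigma j by case/andP: (sigma01 j).
apply: (subclosed_compact _ (@compact_cube R m)); last first.
  move=> x xE j; rewrite (le_trans (ellipsoid_coord_le p0 sigma0 xE j))//.
  by case/andP: (sigma01 j).
have scale_cont : continuous (fun x : 'cV[R]_m => \col_j (x j 0 / sigma j)).
  apply: continuous_col => j x.
  apply: (@continuous_comp _ _ _ (fun y : 'cV[R]_m => y j 0)
    ( *%R^~ (sigma j)^-1)).
    exact: coord_continuous.
  exact: mulrr_continuous.
rewrite (_ : ellipsoid p sigma = (@lpnorm R p m \o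
  (fun x : 'cV[R]_m => \col_j (x j 0 / sigma j))) @^-1` [set t | t <= 1])//.
apply: preimage_closed; last exact: closed_le.
move=> x _; apply: continuous_comp; first exact: scale_cont.
exact: continuous_lpnorm.
Qed.

Lemma cluster_le0 (R : realType) (U : topologicalType) (u : nat -> U) (y : U)
  (f : U -> R) (b : nat -> R) :
  cluster (u @ \oo) y -> continuous f -> (forall k, f (u k) <= b k) ->
  b @ \oo --> 0 -> f y <= 0.
Proof.
move=> uy fc fub b0; rewrite leNgt; apply/negP => fy0.
have e0 : 0 < f y / 2 by rewrite divr_gt0.
have [z [[k /= bk <-] /= fyk]] : exists z,
    ([set u k | k in [set k | b k < f y / 2]] `&`
     [set z | `|f y - f z| < f y / 2]) z.
  apply: uy; last by have /cvgrPdist_lt := fc y; exact.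
  have /cvgrPdist_lt/(_ _ e0) := b0; apply: filterS => k /=.
  rewrite sub0r normrN => bk; exists k => //=.
  exact: le_lt_trans (ler_norm _) bk.
have := le_lt_trans (ler_norm _) fyk; have := le_lt_trans (fub k) bk; lra.
Qed.

Lemma approx_rational_vector (R : realType) (m : nat) (x : 'cV[R]_m) (t : R) :
  0 < t -> exists q : 'cV[rat]_m, forall j, `|x j 0 - ratr (q j 0)| < t.
Proof.
move=> t0.
have ex j : exists a : rat, `|x j 0 - ratr a| < t.
  have [|a] := @rat_in_itvoo R (x j 0 - t) (x j 0 + t).
    by rewrite ltrD2l; rewrite gtrN.
  rewrite in_itv/= => /andP[xa ax]; exists a.
  by rewrite ltr_norml; apply/andP; split; lra.
have [a aP] := choice ex.
by exists (\col_j a j) => j; rewrite mxE.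
Qed.

(** Vectors near [K] that are nearly in the kernel and have norm nearly [c], to
    within every precision, cluster by compactness at a true kernel vector in
    [K]. The approximating vectors can be rational, so the right-hand side
    involves countably many conditions, each on finitely many linear
    combinations of the entries of [A]. *)
Lemma rad_geP (R : realType) (n m : nat) (K : set 'cV[R]_m) (A : 'M[R]_(n, m))
  (c : R) : compact K ->
  (c%:E <= rad K A)%E <->
  forall k : nat, exists q : 'cV[rat]_m,
    (exists x, [/\ K x, c - k.+1%:R^-1 < lpnorm 2 x &
       forall j, `|x j 0 - ratr (q j 0)| < k.+1%:R^-1]) /\
    forall r, `|(A *m map_mx ratr q) r 0| < k.+1%:R^-1.
Proof.
move=> cK; set B : R := \sum_r \sum_j `|A r j|.
have B0 : 0 <= B by apply: sumr_ge0 => r _; exact: sumr_ge0.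
have mulB (z : 'cV[R]_m) (t : R) r : (forall j, `|z j 0| <= t) ->
    0 <= t -> `|(A *m z) r 0| <= B * t.
  move=> zt t0; rewrite mxE (le_trans (ler_norm_sum _ _ _))//.
  rewrite (@le_trans _ _ (\sum_j `|A r j| * t))//.
    by apply: ler_sum => j _; rewrite normrM ler_wpM2l.
  rewrite -mulr_suml ler_wpM2r// /B (bigD1 r)//= lerDl.
  by apply: sumr_ge0 => i _; exact: sumr_ge0.
split=> [cA k|approx].
  (* The tolerance is so small that [A] maps the error below 1 / (k+1). *)
  have k0 : 0 < k.+1%:R^-1 :> R by rewrite invr_gt0.
  have /ereal_sup_gt[_ [x [Kx Ax0] <-]] : ((c - k.+1%:R^-1)%:E < rad K A)%E.
    by apply: lt_le_trans cA; rewrite lte_fin ltrBlDr ltrDl.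
  rewrite lte_fin => cx.
  have B1 : 0 < B + 1 by rewrite ltr_wpDl.
  have t0 : 0 < k.+1%:R^-1 / (B + 1) by rewrite divr_gt0.
  have [q xq] := approx_rational_vector x t0.
  exists q; split.
    exists x; split => // j; rewrite (lt_le_trans (xq j))// ler_pdivrMr//.
    by rewrite ler_peMr ?lerDr// ltW.
  move=> r; have -> : A *m map_mx ratr q = - (A *m (x - map_mx ratr q)).
    by rewrite mulmxBr Ax0 sub0r opprK.
  rewrite mxE normrN (@le_lt_trans _ _ (B * (k.+1%:R^-1 / (B + 1))))//.
    by apply: mulB; rewrite ?ltW// => j; rewrite !mxE ltW// xq.
  by rewrite mulrCA gtr_pMr// ltr_pdivrMr// mul1r ltrDl.
(* Conversely, the vectors of [K] near the rational ones cluster at a point of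
   [K] that is in the kernel and has norm at least [c]. *)
have [q qP] := choice approx.
have [x xP] := choice (fun k => (qP k).1).
have [|y [Ky xy]] := cK (x @ \oo) _ _.
  by exists 0%N => // k _; have [] := xP k.
have invS0 : (fun k => k.+1%:R^-1 : R) @ \oo --> (0 : R) by exact: cvg_harmonic.
have cy : c <= lpnorm 2 y.
  rewrite -subr_le0.
  apply: (@cluster_le0 _ _ x y (fun z => c - lpnorm 2 z)
    (fun k => k.+1%:R^-1)) => //.
    move=> z; apply: continuousB; first exact: cst_continuous.
    exact: continuous_lpnorm.
  by move=> k; have [_ /ltW + _] := xP k; rewrite !lerBlDr addrC.
have Ay : A *m y = 0.
  apply/colP => r; rewrite [RHS]mxE; apply/eqP; rewrite -normr_le0.
  apply: (@cluster_le0 _ _ x y (fun z => `|(A *m z) r 0|)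
    (fun k => (B + 1) * k.+1%:R^-1)) => //.
  - rewrite (_ : (fun z => _) = Num.norm \o
      (fun z : 'cV[R]_m => \sum_j A r j * z j 0)); last first.
      by apply/funext => z; rewrite /= mxE.
    move=> z; apply: continuous_comp; last exact: norm_continuous.
    apply: continuous_big => [|j _]; first exact: add_continuous.
    move=> {}z; apply: (@continuous_comp _ _ _ (fun y : 'cV[R]_m => y j 0)
      ( *%R (A r j))).
      exact: coord_continuous.
    exact: mulrl_continuous.
  - move=> k; have [_ _ xq] := xP k.
    have -> : A *m x k =
        A *m (x k - map_mx ratr (q k)) + A *m map_mx ratr (q k).
      by rewrite -mulmxDr subrK.
    rewrite mxE mulrDl mul1r (le_trans (ler_normD _ _))// lerD//.
      by apply: mulB => [j|]; rewrite ?invr_ge0// !mxE ltW.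
    by rewrite ltW// (qP k).2.
  - rewrite -(mulr0 (B + 1)); apply: cvgM => //; exact: cvg_cst.
apply: (@le_trans _ _ (lpnorm 2 y)%:E); first by rewrite lee_fin.
by apply: ereal_sup_ubound; exists y.
Qed.

Lemma measurable_rad_ge (R : realType) (d : measure_display)
  (T : measurableType d) (P : probability T R) (n m : nat)
  (G : 'I_n -> 'I_m -> {RV P >-> R}) (K : set 'cV[R]_m) (c : R) :
  compact K ->
  measurable [set w | (c%:E <= rad K (random_matrix G w))%E].
Proof.
move=> cK.
pose near_K k (q : 'cV[rat]_m) := exists x,
  [/\ K x, c - k.+1%:R^-1 < lpnorm 2 x &
    forall j, `|x j 0 - ratr (q j 0)| < k.+1%:R^-1].
pose near_ker k (q : 'cV[rat]_m) : set T :=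
  [set w | forall r, `|(random_matrix G w *m map_mx ratr q) r 0| < k.+1%:R^-1].
rewrite (_ : [set w | _] =
    \bigcap_k \bigcup_q ([set _ : T | near_K k q] `&` near_ker k q));
  last first.
  apply/seteqP; split => w /=.
    by move=> /(rad_geP _ _ cK) H k _; have [q qP] := H k; exists q.
  move=> H; apply/(rad_geP _ _ cK) => k.
  by have [q _ qP] := H k I; exists q.
apply: bigcap_measurable => [|k _]; first by exists 0%N.
apply: countable_bigcupT_measurable => [|q]; first exact: countableP.
apply: measurableI.
  have [kq|kq] := pselect (near_K k q).
    by rewrite (_ : [set _ | _] = setT)//; apply/seteqP; split.
  by rewrite (_ : [set _ | _] = set0)//; apply/seteqP; split.
rewrite (_ : near_ker k q = \bigcap_(r in [set: 'I_n])
    (fun w => \sum_j G r j w * ratr (q j 0)) @^-1`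
      `]- k.+1%:R^-1, k.+1%:R^-1[); last first.
  have entryE w r : (random_matrix G w *m map_mx ratr q) r 0 =
      \sum_j G r j w * ratr (q j 0).
    by rewrite mxE; apply: eq_bigr => j _; rewrite !mxE.
  apply/seteqP; split => w /= H r; have := H r;
    rewrite /= in_itv/= -ltr_norml entryE //.
  exact.
apply: fin_bigcap_measurable => // r _.
rewrite -[_ @^-1` _]setTI.
suff : measurable_fun setT (fun w => \sum_j G r j w * ratr (q j 0)) by apply.
by apply: measurable_sum => j; apply: measurable_funM.
Qed.

(** * The radius of random sections *)

Theorem proposition1 (R : realType) (p pstar lambda : R)
  (hp1 : 1 < p) (hp2 : p <= 2) (hpstar : p^-1 + pstar^-1 = 1)
  (hlambda0 : 0 < lambda) (hlambda1 : lambda < pstar^-1)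
  (eps : R) (heps0 : 0 < eps) (heps1 : eps < 1)
  (n : nat) (hn : (0 < n)%N) :
  exists m0 : nat, (n < m0)%N /\
    forall m : nat, (m0 <= m)%N ->
    forall (d : measure_display) (T : measurableType d) (P : probability T R)
      (G : 'I_n -> 'I_m -> {RV P >-> R}),
      iid_gaussian_entries G ->
      (P [set w | (2^-1)%:E <=
                  rad (ellipsoid p (@poly_semiaxes R lambda m))
                      (random_matrix G w)] >= (1 - eps)%:E)%E.
Proof.
have n0 : 0 < n%:R :> R by rewrite ltr0n.
have p0 : 0 < p by exact: lt_trans hp1.
pose delta : R := (2 * n%:R)^-1.
have delta0 : 0 < delta by rewrite invr_gt0 mulr_gt0.
(* Each q_i is at most 1, so their product bounds all of them from below. *)
pose q i := near_basis_prob delta (i : 'I_n).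
have q_gt0 i : 0 < q i by exact: near_basis_prob_gt0.
pose q0 := \prod_i q i.
have q0_gt0 : 0 < q0 by exact: prodr_gt0.
have q0_le i : q0 <= q i.
  rewrite /q0 (bigD1 i)//= ler_piMr ?(ltW (q_gt0 i))//.
  by apply: prodr_ile1 => k _; rewrite ltW//= near_basis_prob_le1.
(* There are 2 n exceptional events, one for each entry of the first column and
   one for each basis vector; each may have probability eps / (2 n). *)
pose eta := eps / (2 * n%:R).
have eta0 : 0 < eta by rewrite divr_gt0// mulr_gt0.
have [M M0 tailM] := probability_tail_small (normal_prob (0 : R) 1) eta0.
(* With groups of at least s = m q0 / 2 columns, the bound n M / s on the
   coordinates of the kernel vector is C / m. *)
pose C := 2 * n%:R * M / q0.
have C0 : 0 <= C by rewrite !mulr_ge0 ?invr_ge0// ltW.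
have lambda_lt : lambda < 1 - p^-1 by rewrite -hpstar addrC addKr.
have [m1 m1P] := eventually_small_spread hp1 hlambda0 lambda_lt C0.
pose m2 := (Num.trunc (4 / (q0 * eta))).+1.
exists (maxn n (maxn m1 m2)).+1; split; first by rewrite ltnS leq_maxl.
case=> // m; rewrite ltnS !geq_max => /and3P[_ m1m m2m] d T P G iidG.
have m_gt0 : 0 < m%:R :> R by rewrite ltr0n (leq_trans _ m2m).
have few_le i : 4 / (m%:R * q i) <= eta.
  rewrite ler_pdivrMr ?mulr_gt0//.
  have m_large : 4 / (q0 * eta) <= m%:R.
    by rewrite ltW// (lt_le_trans (truncnS_gt _))// ler_nat.
  move: m_large; rewrite ler_pdivrMr ?mulr_gt0// => /le_trans; apply.
  have -> : m%:R * (q0 * eta) = eta * (m%:R * q0) by ring.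
  by rewrite !ler_pM2l.
pose A i j := near_basis G delta i (lift ord0 j).
pose few i :=
  [set w | (#|[set j | w \in A i j]%SET|%:R < m%:R * q i / 2 :> R)%R].
have fewP i : measurable (few i) /\ (P (few i) <= eta%:E)%E.
  have [|mfew Pfew] := @few_columns_near_basis R d T P n m G delta i
    iidG delta0 _; first by rewrite -(ltr0n R).
  by split=> //; apply: le_trans Pfew _; rewrite lee_fin.
pose large r := G r ord0 @^-1` [set x : R | M < `|x|].
have mtail := measurable_normr_gt M.
have largeP r : measurable (large r) /\ (P (large r) <= eta%:E)%E.
  split; first exact: measurable_funPTI.
  by rewrite -[P _]/(distribution P (G r ord0) _) (iidG.2 r ord0).
set good := [set w | _].
have mgood : measurable good.
  apply: measurable_rad_ge; apply: compact_ellipsoid => // j.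
  rewrite /poly_semiaxes powR_gt0//= powRN invf_le1 ?powR_gt0//.
  by rewrite -[leLHS](powRr0 (j.+1%:R)) ler_powR ?ler1n// ltW.
have goodP : ~` good `<=` \bigcup_(k : 'I_n + 'I_n)
    (match k with inl r => large r | inr i => few i end).
  move=> w; apply: contra_notP => notbad.
  apply: (@rad_ge_half_of_clusters _ _ _ _ m (random_matrix G w)
    (fun i => [set j | w \in A i j]%SET) (m%:R * q0 / 2) M) => //.
  - by rewrite divr_gt0// mulr_gt0.
  - move=> i; rewrite (@le_trans _ _ (m%:R * q i / 2))//.
      by rewrite ler_pM2r// ler_pM2l.
    by rewrite leNgt; apply/negP => few_w; apply: notbad; exists (inr i).
  - by move=> i j r; rewrite !inE !mxE => /(_ r).
  - move=> r; rewrite mxE leNgt; apply/negP => large_w.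
    by apply: notbad; exists (inl r).
  rewrite (_ : n%:R * M / _ = C / m%:R) ?m1P// /C; field.
  by rewrite !gt_eqF.
have Pbad : (P (~` good) <= eps%:E)%E.
  have -> : eps = #|{: 'I_n + 'I_n}|%:R * eta.
    by rewrite card_sum card_ord natrD /eta; field; rewrite gt_eqF.
  apply: union_bound goodP; first exact: measurableC.
    by case=> i; [exact: (largeP i).1|exact: (fewP i).1].
  by case=> i; [exact: (largeP i).2|exact: (fewP i).2].
have finP : P good \is a fin_num by exact: fin_num_measure.
move: Pbad; rewrite probability_setC// -(fineK finP) -EFinB !lee_fin; lra.
Qed.
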